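(* Let $G$ be an $m$-strategy CRS game ($m\ge 2$) on an arbitrary finite network, with all three player sets $C$, $R$, $S$ nonempty. For $a\in A$ let $S_a\subseteq S$ be the set of stubborn agents whose fixed strategy is $a$. Then $G$ admits a pure strategy Nash equilibrium (PNE) if one of the following conditions holds: (i) there is no edge between a conformist and a rebel; (ii) there exists a strategy $a\in A$ such that every conformist $i\in C$ has at least $\tfrac12$ of his/her neighbors in $C\cup S_a$, i.e. $|N_i\cap (C\cup S_a)|\ge \tfrac12 |N_i|$.
   Context: An $m$-strategy CRS game consists of a finite set of players $N=C\cup R\cup S$ (disjoint union of conformists $C$, rebels $R$ and stubborn agents $S$), a set $E\neq\emptyset$ of undirected edges on $N$ without loops, and a strategy set $A=\{a_1,\dots,a_m\}$ common to all players. $N_i=\{j: ij\in E\}$ is the set of neighbors of $i$. Each stubborn agent has a predetermined fixed strategy in $A$ which it never changes, so strategy profiles $\boldsymbol x=(x_i)_{i\in N}\in A^N$ always have $x_i$ equal to the fixed strategy for $i\in S$. Payoffs are $u_i(\boldsymbol x)=|\{j\in N_i: x_j=x_i\}|$ for $i\in C$, $u_i(\boldsymbol x)=|\{j\in N_i: x_j\ne x_i\}|$ for $i\in R$, and $u_i(\boldsymbol x)=0$ for $i\in S$. A profile $\boldsymbol x^*$ is a PNE if no conformist or rebel $i$ can strictly increase $u_i$ by unilaterally changing its strategy: $u_i(\boldsymbol x^* )\ge u_i(x_i,\boldsymbol x^*_{-i})$ for all $x_i\in A$. *)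

(* Defs.v *)
From mathcomp Require Import all_boot.

Set Implicit Arguments.
Unset Strict Implicit.
Unset Printing Implicit Defensive.

(* Giving every player a role encodes the disjoint union of conformists,
   rebels and stubborn agents, and attaches a predetermined strategy to the
   stubborn agents only. *)
Inductive role (m : nat) : Type :=
  | Conformist
  | Rebel
  | Stubborn of 'I_m.

Arguments Conformist {m}.
Arguments Rebel {m}.

Record crs_game (m : nat) (N : finType) : Type := CRSGame {
  role_of : N -> role m;
  edge : rel N;
  edge_sym : symmetric edge;
  edge_irrefl : irreflexive edge;
  edge_nonempty : exists i j, edge i j
}.

Section Game.

Variables (m : nat) (N : finType) (G : crs_game m N).

Definition conformists : {set N} :=
  [set i | if role_of G i is Conformist then true else false].

Definition rebels : {set N} :=
  [set i | if role_of G i is Rebel then true else false].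

Definition stubborns : {set N} :=
  [set i | if role_of G i is Stubborn _ then true else false].

Definition stubborns_at (a : 'I_m) : {set N} :=
  [set i | if role_of G i is Stubborn b then b == a else false].

Definition neighbors (i : N) : {set N} := [set j | edge G i j].

Definition profile (x : {ffun N -> 'I_m}) : Prop :=
  forall i a, role_of G i = Stubborn a -> x i = a.

Definition payoff (i : N) (x : {ffun N -> 'I_m}) : nat :=
  match role_of G i with
  | Conformist => #|[set j in neighbors i | x j == x i]|
  | Rebel => #|[set j in neighbors i | x j != x i]|
  | Stubborn _ => 0
  end.

Definition deviate (x : {ffun N -> 'I_m}) (i : N) (a : 'I_m) :
    {ffun N -> 'I_m} :=
  [ffun j => if j == i then a else x j].

Definition PNE (x : {ffun N -> 'I_m}) : Prop :=
  profile x /\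
  forall i, i \in conformists :|: rebels ->
  forall a : 'I_m, payoff i (deviate x i a) <= payoff i x.

End Game.

(* Main.v *)
Require Import Defs.
From mathcomp Require Import all_boot.

(** Give every edge touching a rebel the wish that its ends differ, and every
    other edge the wish that they agree.  A rebel's payoff is the number of
    satisfied edges at it, and so is the payoff of a conformist without rebel
    neighbours; hence the number of satisfied edges is an exact potential for
    such players, and maximizing it leaves all of them without a profitable
    deviation.  Under (i) this applies to all non-stubborn players at once.
    Under (ii), let all conformists play [a] and maximize over the rebels'
    strategies only: each conformist sees [a] at half of its neighbours at
    least, whatever the rebels do. *)

Section Potential.

Variables (m : nat) (N : finType) (G : crs_game m N).
Implicit Types (x : {ffun N -> 'I_m}) (i : N) (a : 'I_m).

Definition satisfied x i j : bool :=
  edge G i j && ((x i == x j) == (i \notin rebels G) && (j \notin rebels G)).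

Lemma satisfied_sym x : symmetric (satisfied x).
Proof.
by move=> i j; rewrite /satisfied edge_sym [x i == _]eq_sym [(i \notin _) && _]andbC.
Qed.

Definition potential x : nat := \sum_i \sum_j satisfied x i j.

(** [potential] runs over ordered pairs, so by symmetry each edge at [i] counts twice; the remaining
    double sum does not depend on [x i]. *)
Lemma potential_split x i :
  potential x = 2 * (\sum_j satisfied x i j)
    + \sum_(j | j != i) \sum_(k | k != i) satisfied x j k.
Proof.
rewrite /potential (bigD1 i) //= mul2n -addnn -addnA; congr (_ + _).
under eq_bigr => j _ do rewrite (bigD1 i) //=.
rewrite big_split /=; congr (_ + _).
(* The diagonal term vanishes, as there are no loops. *)
rewrite [RHS](bigD1 i) //= {2}/satisfied edge_irrefl add0n.
by apply: eq_bigr => j _; rewrite satisfied_sym.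
Qed.

Lemma potential_deviate x i a :
  (potential (deviate x i a) <= potential x)
    = (\sum_j satisfied (deviate x i a) i j <= \sum_j satisfied x i j).
Proof.
rewrite (potential_split x i) (potential_split _ i).
have -> : \sum_(j | j != i) \sum_(k | k != i) satisfied (deviate x i a) j k
        = \sum_(j | j != i) \sum_(k | k != i) satisfied x j k.
  apply: eq_bigr => j /negPf ji; apply: eq_bigr => k /negPf ki.
  by rewrite /satisfied !ffunE ji ki.
by rewrite leq_add2r leq_pmul2l.
Qed.

Lemma sum_satisfied x i :
  i \in conformists G :|: rebels G ->
  (i \in conformists G -> forall j, j \in rebels G -> ~~ edge G i j) ->
  \sum_j satisfied x i j = payoff G i x.
Proof.
move=> iCR iC; rewrite -big_mkcond /= sum1_card.
rewrite /payoff; move: iCR iC; rewrite /satisfied !inE.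
case: role_of => //= _ iC; rewrite -[LHS]cardsE; apply: eq_card => j.
  have := iC isT j; rewrite !inE unfold_in /= inE [x i == _]eq_sym.
  by case: (edge G i j) => //=; case: role_of => [|/(_ isT)|b] //; rewrite eqb_id.
by rewrite !inE unfold_in /= [x i == _]eq_sym eqbF_neg.
Qed.

(** The maximum of [potential] is taken among the assignments equal to [x0] off [A], a class closed
    under deviations of members of [A]. *)
Lemma optimal_on (A : {set N}) (x0 : {ffun N -> 'I_m}) :
  A \subset conformists G :|: rebels G ->
  (forall i j, i \in A :&: conformists G -> j \in rebels G -> ~~ edge G i j) ->
  exists2 x : {ffun N -> 'I_m}, {in ~: A, x =1 x0} &
    {in A, forall i a, payoff G i (deviate x i a) <= payoff G i x}.
Proof.
move=> /subsetP sA noCR.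
pose P x := [forall j in ~: A, x j == x0 j].
have P0 : P x0 by apply/forall_inP.
case: (arg_maxnP potential P0) => x /forall_inP Px xmax.
exists x => [j jA | i iA a]; first exact/eqP/Px.
have payoffE y : \sum_j satisfied y i j = payoff G i y.
  by apply: sum_satisfied => [|iC j]; [exact: sA | apply: noCR; apply/setIP].
rewrite -!payoffE -potential_deviate; apply: xmax.
apply/forall_inP => j jA; rewrite ffunE; case: (eqVneq j i) => [ji|_]; last exact: Px.
by move: jA; rewrite ji inE iA.
Qed.

Definition default_profile a : {ffun N -> 'I_m} :=
  [ffun j => if role_of G j is Stubborn b then b else a].

Lemma profile_default a x :
  {in ~: (conformists G :|: rebels G), x =1 default_profile a} -> profile G x.
Proof.
by move=> xE i b ib; rewrite xE ?ffunE ?ib // !inE ib.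
Qed.

(** After a switch away from [a], the neighbors agreeing with [i] are among those not playing [a],
    at most half of all. *)
Lemma conformist_optimal x i a :
  i \in conformists G ->
  #|neighbors G i| <= 2 * #|[set j in neighbors G i | x j == a]| -> x i = a ->
  forall b, payoff G i (deviate x i b) <= payoff G i x.
Proof.
rewrite inE /payoff; case: (role_of G i) => // _ half xi b.
have [ba | ba] := eqVneq b a.
  apply/subset_leq_card/subsetP => j; rewrite !inE !ffunE eqxx xi ba.
  by case: (eqVneq j i) => [-> |//]; rewrite edge_irrefl.
rewrite xi.
have sub : [set j in neighbors G i | deviate x i b j == deviate x i b i]
    \subset neighbors G i :\: [set j in neighbors G i | x j == a].
  apply/subsetP => j; rewrite !inE !ffunE eqxx.
  case: (eqVneq j i) => [-> |_]; first by rewrite edge_irrefl.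
  by case/andP => -> /eqP -> /=; rewrite ba.
apply: leq_trans (subset_leq_card sub) _.
rewrite cardsDS; last by apply/subsetP => j; rewrite !inE => /andP[].
by rewrite leq_subLR addnn -mul2n.
Qed.

End Potential.

Theorem theorem1 (m : nat) (N : finType) (G : crs_game m N) :
  2 <= m ->
  conformists G != set0 -> rebels G != set0 -> stubborns G != set0 ->
  (forall i j : N, i \in conformists G -> j \in rebels G -> ~~ edge G i j)
  \/ (exists a : 'I_m, forall i : N, i \in conformists G ->
        #|neighbors G i|
          <= 2 * #|neighbors G i :&: (conformists G :|: stubborns_at G a)|) ->
  exists x : {ffun N -> 'I_m}, PNE G x.
Proof.
move=> m_ge2 _ _ _ [noCR | [a half]].
  (* Any strategy would do as the starting value for the non-stubborn players; this one is 0. *)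
  pose a0 : 'I_m := Ordinal (ltnW m_ge2).
  case: (@optimal_on _ _ G (conformists G :|: rebels G) (default_profile m N G a0)).
  - exact: subxx.
  - by move=> i j /setIP[_]; apply: noCR.
  by move=> x xE xopt; exists x; split; first exact: profile_default xE.
case: (@optimal_on _ _ G (rebels G) (default_profile m N G a)).
- exact: subsetUr.
- by move=> i j /setIP[]; rewrite !inE; case: role_of.
move=> x xE xopt; exists x; split.
  apply: (@profile_default _ _ _ a) => j jCR; apply: xE.
  by move: jCR; rewrite !inE negb_or => /andP[].
(* These players are not rebels, so the maximization left them at their default, which is [a]. *)
have xa j : j \in conformists G :|: stubborns_at G a -> x j = a.
  rewrite !inE => ja; rewrite xE ?inE ?ffunE; case: role_of ja => //.
  by move=> b /eqP.
move=> i /setUP[iC | iR] b; last exact: xopt.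
apply: (@conformist_optimal _ _ _ _ _ a) => //; last by rewrite xa // inE iC.
apply: leq_trans (half i iC) _; rewrite leq_pmul2l //.
apply/subset_leq_card/subsetP => j /setIP[ij ja].
by rewrite inE ij xa ?eqxx.
Qed.
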